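(* Let $K:\mathcal X\to\mathcal Y$ be a compact linear operator with $\|K\|=1$, and let $\{\alpha_n\}_{n\in\mathbb N},\{r_n\}_{n\in\mathbb N}$ be sequences of positive real numbers satisfying one of the following two conditions: (1) $\sup_{k\in\mathbb N}r_k=r\in[0,\infty)$ and $\sum_{k=1}^\infty\alpha_k^{-1}=\infty$; (2) $\lim_{k\to\infty}r_k=\infty$ monotonically and $\big(\sum_{k=1}^n\alpha_k^{-1}\big)^{-1}=o(\sigma^{r_n+1})$ as $n\to\infty$ for every $\sigma\in\sigma(K)\setminus\{0\}$. Let $y\in R(K)$ and $x^\dagger=K^\dagger y$. If $\{\delta_n\}$ is a sequence convergent to $0$ with $\delta_n\ge0$ and such that $$\lim_{n\to\infty}\delta_n\cdot\sum_{k=1}^n\alpha_k^{-1}=0,$$ then $\lim_{n\to\infty}\|x^\dagger-x_{\alpha_n,r_n}^{n,\delta_n}\|=0$.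
   Context: $\mathcal X,\mathcal Y$ are Hilbert spaces; $R(K)$ is the range of $K$; $K^\dagger$ is the Moore-Penrose generalized inverse. $(\sigma_m;v_m,u_m)$ is the singular value expansion of $K$ ($Kv_m=\sigma_mu_m$, $K^*u_m=\sigma_mv_m$, $\sigma_m>0$ decreasing), so $\sigma_1=\|K\|=1$; $\sigma(K)$ denotes the closure of $\{\sigma_m\}$. Nonstationary iterated weighted Tikhonov method (NSIWT) with datum $z\in\mathcal Y$: $x^0=0$ and, for $j\ge1$, $$\big[(K^*K)^{\frac{r_j+1}2}+\alpha_jI\big]x^j=(K^*K)^{\frac{r_j-1}2}K^*z+\alpha_jx^{j-1},$$ where $(K^*K)^{\frac{r-1}2}K^*z:=\sum_m\sigma_m^{r}\langle z,u_m\rangle v_m$. For $\delta\ge0$, $y^{\delta}=y+\delta\eta$ with $\|\eta\|=1$ ($\eta$ may depend on $\delta$), so that $\|y^\delta-y\|=\delta$; $x_{\alpha_n,r_n}^{n,\delta}$ denotes the $n$-th NSIWT iterate with datum $z=y^\delta$. *)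

(* Defs.v *)
#[export] Set Warnings "-notation-overridden,-ambiguous-paths,-notation-incompatible-prefix".
From HB Require Import structures.
From mathcomp Require Export all_boot all_order all_algebra complex.
From mathcomp Require Export all_classical all_reals all_analysis.
Export Order.TTheory GRing.Theory Num.Theory numFieldNormedType.Exports.
#[global] Set Implicit Arguments.
#[global] Unset Strict Implicit.
#[global] Unset Printing Implicit Defensive.

#[global] Open Scope classical_set_scope.
#[global] Open Scope ring_scope.

(** Real and complex Hilbert spaces are treated uniformly: the scalar field is
    [R] or [R[i]], and [of_real], [re_part], [conj_scalar] are the embedding of
    the reals, the real part and the conjugation. *)
Variant base_field := RealField | ComplexField.

Definition scalar (R : realType) (k : base_field) : numFieldType :=
  match k with RealField => R | ComplexField => R[i] end.

Definition of_real (R : realType) (k : base_field) : R -> scalar R k :=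
  match k with RealField => fun a => a | ComplexField => fun a => a%:C%C end.

Definition re_part (R : realType) (k : base_field) : scalar R k -> R :=
  match k with RealField => fun a => a | ComplexField => fun a => complex.Re a end.

Definition conj_scalar (R : realType) (k : base_field) : scalar R k -> scalar R k :=
  match k with RealField => fun a => a | ComplexField => fun a => conjc a end.

(** The form is linear in its first argument and conjugate-linear in its
    second one. *)
Record hilbertSpace (R : realType) (k : base_field) := HilbertSpace {
  hilbert_carrier :> completeNormedModType (scalar R k);
  hilbert_dot : {dot hilbert_carrier for @conj_scalar R k};
  hilbert_normE : forall x : hilbert_carrier, `|x| ^+ 2 = hilbert_dot x x }.

Definition inner (R : realType) (k : base_field) (X : hilbertSpace R k)
  (x y : X) : scalar R k := hilbert_dot X x y.

Notation "'<|' x , y '|>'" := (inner x y)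
  (at level 0, x at level 99, y at level 99,
   format "'<|'  x ,  y  '|>'") : ring_scope.

(** The norm of a normed module over [scalar R k] takes its (real) values in
    [scalar R k]. *)
Definition hnorm (R : realType) (k : base_field) (X : hilbertSpace R k)
  (x : X) : R := re_part `|x|.

Section Operators.
Context {R : realType} {k : base_field} {X Y : hilbertSpace R k}.
Implicit Type K : {linear X -> Y}.

Definition compact_operator K : Prop :=
  compact (closure (K @` [set x : X | hnorm x <= 1])).

(** Since [sup] is [0] on unbounded sets, [opnorm K = 1] entails that [K] is
    bounded. *)
Definition opnorm K : R := sup [set hnorm (K x) | x in [set x : X | hnorm x <= 1]].

Definition adjoint K (y : Y) : X :=
  xget 0 [set x' | forall x, <| K x, y |> = <| x, x' |>].

Definition kernel K : set X := [set x | K x = 0].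

(** [pinv K] is the linear extension of the inverse of the restriction of [K]
    to the orthogonal complement of its kernel, to the domain
    R(K) + R(K)^perp, with kernel R(K)^perp; it is [0] outside this domain. *)
Definition orthocomp (Z : hilbertSpace R k) (A : set Z) : set Z :=
  [set z | forall a, A a -> <| z, a |> = 0].

Definition pinv K (y : Y) : X :=
  xget 0 [set x | orthocomp (kernel K) x /\ orthocomp (range K) (y - K x)].

Definition partial_sums (Z : hilbertSpace R k) (I : set nat) (f : nat -> Z) :
  nat -> Z := fun n => \sum_(m < n | (m : nat) \in I) f m.

Definition hsum (Z : hilbertSpace R k) (I : set nat) (f : nat -> Z) : Z :=
  lim (partial_sums I f @ \oo).

(** The singular values are repeated according to multiplicity and indexed from
    [0]; [sv_index] is an initial segment of [nat], finite when [K] has finite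
    rank, and the values of the three sequences outside it are irrelevant. *)
Record singular_expansion K := SingularExpansion {
  sv_index : set nat;
  sv : nat -> R;
  sv_right : nat -> X;
  sv_left : nat -> Y;
  sv_index_initial : forall m n, (m <= n)%N -> sv_index n -> sv_index m;
  sv_gt0 : forall m, sv_index m -> 0 < sv m;
  sv_decreasing : forall m n, (m <= n)%N -> sv_index n -> sv n <= sv m;
  sv_right_orthonormal : forall m n, sv_index m -> sv_index n ->
    <| sv_right m, sv_right n |> = (m == n)%:R;
  sv_left_orthonormal : forall m n, sv_index m -> sv_index n ->
    <| sv_left m, sv_left n |> = (m == n)%:R;
  sv_rightE : forall m, sv_index m ->
    K (sv_right m) = of_real k (sv m) *: sv_left m;
  sv_leftE : forall m, sv_index m ->
    adjoint K (sv_left m) = of_real k (sv m) *: sv_right m;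
  sv_expansion : forall x : X,
    partial_sums sv_index
      (fun m => (of_real k (sv m) * <| x, sv_right m |>) *: sv_left m) n
      @[n --> \oo] --> K x }.

Section Filters.
Context {K} (S : singular_expansion K).

Definition sv_spectrum : set R := closure (sv S @` sv_index S).

(** [(K^* K)^s] for [s > 0] (so that the kernel of [K] does not contribute) *)
Definition gram_pow (s : R) (x : X) : X :=
  hsum (sv_index S) (fun m =>
    (of_real k ((sv S m ^+ 2) `^ s) * <| x, sv_right S m |>) *: sv_right S m).

(** [(K^* K)^((r - 1) / 2) K^*] *)
Definition gram_pow_adjoint (r : R) (z : Y) : X :=
  hsum (sv_index S) (fun m =>
    (of_real k (sv S m `^ r) * <| z, sv_left S m |>) *: sv_right S m).

(** [nsiwt alpha r z j] is the iterate x^j with datum [z]; the parameters are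
    indexed from [1]. *)
Fixpoint nsiwt (alpha r : nat -> R) (z : Y) (j : nat) : X :=
  match j with
  | 0%N => 0
  | i.+1 => xget 0 [set x |
      gram_pow ((r i.+1 + 1) / 2) x + of_real k (alpha i.+1) *: x
      = gram_pow_adjoint (r i.+1) z + of_real k (alpha i.+1) *: nsiwt alpha r z i]
  end.

End Filters.
End Operators.

Definition inv_sum (R : realType) (alpha : nat -> R) (n : nat) : R :=
  \sum_(1 <= j < n.+1) (alpha j)^-1.

(* Main.v *)
From HB Require Import structures.
From mathcomp Require Import ring lra.
Require Import Defs.

(** Write sigma_m for the singular values, A_j for the operator
    (K^* K)^((r_j + 1) / 2), B_j for (K^* K)^((r_j - 1) / 2) K^*, and x for the
    pseudo-inverse solution. Both A_j and B_j act diagonally on the singular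
    vectors, with multipliers in [0, 1] because ||K|| = 1.

    Since K x = y, the operators satisfy B_j y = A_j x. Hence an iteration with
    datum z has the error recurrence
      (A_j + alpha_j) (x - x^j) = alpha_j (x - x^(j-1)) + B_j (y - z).
    On the singular vector v_m the homogeneous recurrence multiplies by
    alpha_j / (sigma_m^(r_j + 1) + alpha_j), so that, starting from a truncation
    p^0 of the singular expansion of x to finitely many terms, it has the
    explicit solution p^n whose m-th coefficient is that of x times
      g_m(n) = prod_(i <= n) alpha_i / (sigma_m^(r_i + 1) + alpha_i).
    The difference q^j = x - x^j - p^j satisfies the same recurrence as the
    error. As A_j is positive, ||(A_j + alpha_j) q|| >= alpha_j ||q||, and as
    B_j is a contraction, one gets (nsiwt_error)
      ||x - x^n - p^n|| <= ||x - p^0|| + ||y - z|| sum_(i <= n) 1 / alpha_i.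
    With z = y + delta_n eta_n the last term tends to 0 by assumption. The first
    one is arbitrarily small because x, being orthogonal to the kernel of K, is
    the sum of its singular expansion (coimage_proj_id).

    It remains that p^n tends to 0, for which g_m(n) must tend to 0 for each of
    the finitely many m involved. Expanding the product gives
      1 / g_m(n) >= 1 + sum_(i <= n) sigma_m^(r_i + 1) / alpha_i,
    and as sigma_m <= 1 this is at least sigma_m^(rho + 1) times the sum of the
    1 / alpha_i whenever rho bounds r_1, ..., r_n. The choices rho = sup r_i
    under the first growth condition and rho = r_n under the second one make
    the lower bound diverge. *)

(** * The scalar field *)

Section Scalars.
Context {R : realType} {k : base_field}.
Implicit Types (a b : R) (z : scalar R k).

Fact of_real_is_zmod_morphism : zmod_morphism (@of_real R k).
Proof. by case: k => //= a b; rewrite rmorphB. Qed.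

Fact of_real_is_monoid_morphism : monoid_morphism (@of_real R k).
Proof. by case: k => //=; split=> [|a b]; rewrite ?rmorph1 ?rmorphM. Qed.

Fact conj_scalar_is_zmod_morphism : zmod_morphism (@conj_scalar R k).
Proof. by case: k => //= a b; rewrite rmorphB. Qed.

Fact conj_scalar_is_monoid_morphism : monoid_morphism (@conj_scalar R k).
Proof. by case: k => //=; split=> [|a b]; rewrite ?rmorph1 ?rmorphM. Qed.

Fact re_part_is_zmod_morphism : zmod_morphism (@re_part R k).
Proof. by case: k => //= -[a b] [c d]. Qed.

HB.instance Definition _ :=
  GRing.isZmodMorphism.Build R (scalar R k) (@of_real R k) of_real_is_zmod_morphism.
HB.instance Definition _ :=
  GRing.isMonoidMorphism.Build R (scalar R k) (@of_real R k)
    of_real_is_monoid_morphism.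
HB.instance Definition _ :=
  GRing.isZmodMorphism.Build (scalar R k) (scalar R k) (@conj_scalar R k)
    conj_scalar_is_zmod_morphism.
HB.instance Definition _ :=
  GRing.isMonoidMorphism.Build (scalar R k) (scalar R k) (@conj_scalar R k)
    conj_scalar_is_monoid_morphism.
HB.instance Definition _ :=
  GRing.isZmodMorphism.Build (scalar R k) R (@re_part R k) re_part_is_zmod_morphism.

Lemma of_realK : cancel (@of_real R k) (@re_part R k).
Proof. by case: k. Qed.

Lemma ler_of_real a b : (of_real k a <= of_real k b) = (a <= b).
Proof. by case: k => //=; rewrite lecR. Qed.

Lemma ltr_of_real a b : (of_real k a < of_real k b) = (a < b).
Proof. by case: k => //=; rewrite ltcR. Qed.

Lemma of_real_ge0 a : (0 <= of_real k a) = (0 <= a).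
Proof. by rewrite -(rmorph0 (@of_real R k)) ler_of_real. Qed.

Lemma of_real_gt0 a : (0 < of_real k a) = (0 < a).
Proof. by rewrite -(rmorph0 (@of_real R k)) ltr_of_real. Qed.

Lemma re_partK z : 0 <= z -> of_real k (re_part z) = z.
Proof. by case: k z => //= z z0; rewrite RRe_real ?ger0_real. Qed.

Lemma conj_of_real a : conj_scalar (of_real k a) = of_real k a.
Proof. by case: k => //=; rewrite oppr0. Qed.

Lemma mul_conj_scalar z : z * conj_scalar z = `|z| ^+ 2.
Proof.
by case: k z => /= z; [rewrite -expr2 real_normK ?num_real | rewrite sqr_normc].
Qed.

Lemma norm_of_real a : `|of_real k a| = of_real k `|a|.
Proof.
have [a0|a0] := leP 0 a.
  by rewrite (ger0_norm a0) ger0_norm// of_real_ge0.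
rewrite (ltr0_norm a0) rmorphN ltr0_norm//.
by rewrite -(rmorph0 (@of_real R k)) ltr_of_real.
Qed.

End Scalars.

(** * Inner products *)

Section Hilbert.
Context {R : realType} {k : base_field} {Z : hilbertSpace R k}.
Implicit Types (x y z : Z) (a : R).

Lemma innerC x y : <|x, y|> = conj_scalar <|y, x|>.
Proof. by rewrite /inner [LHS]hermitian_subproof expr0 mul1r. Qed.

Lemma innerBl x y z : <|x - y, z|> = <|x, z|> - <|y, z|>.
Proof. exact: linearBl. Qed.

Lemma innerDl x y z : <|x + y, z|> = <|x, z|> + <|y, z|>.
Proof. exact: linearDl. Qed.

Lemma innerZl (c : scalar R k) x z : <|c *: x, z|> = c * <|x, z|>.
Proof. exact: linearZl_LR. Qed.

Lemma inner0l x : <|0, x|> = 0.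
Proof. exact: linear0l. Qed.

Lemma inner_suml n (P : pred 'I_n) (f : 'I_n -> Z) z :
  <|\sum_(i | P i) f i, z|> = \sum_(i | P i) <|f i, z|>.
Proof. by elim/big_rec2: _ => [|i a b _ <-]; rewrite ?inner0l ?innerDl. Qed.

Lemma innerDr x y z : <|x, y + z|> = <|x, y|> + <|x, z|>.
Proof. by rewrite innerC innerDl rmorphD /= -!innerC. Qed.

Lemma innerZr (c : scalar R k) x z : <|x, c *: z|> = conj_scalar c * <|x, z|>.
Proof. by rewrite innerC innerZl rmorphM /= -innerC. Qed.

Lemma innerNr x y : <|x, - y|> = - <|x, y|>.
Proof. by rewrite innerC -scaleN1r innerZl mulN1r rmorphN /= -innerC. Qed.

Lemma inner_sumr n (P : pred 'I_n) (f : 'I_n -> Z) z :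
  <|z, \sum_(i | P i) f i|> = \sum_(i | P i) <|z, f i|>.
Proof.
by rewrite innerC inner_suml rmorph_sum /=; apply: eq_bigr => i _; rewrite -innerC.
Qed.

Lemma hnormE x : of_real k (hnorm x) = `|x|.
Proof. by rewrite re_partK. Qed.

Lemma hnorm_ge0 x : 0 <= hnorm x.
Proof. by rewrite -(of_real_ge0 (k := k)) hnormE. Qed.

Lemma ler_hnormD x y : hnorm (x + y) <= hnorm x + hnorm y.
Proof. by rewrite -(ler_of_real (k := k)) rmorphD /= !hnormE ler_normD. Qed.

Lemma hnormN x : hnorm (- x) = hnorm x.
Proof. by rewrite /hnorm normrN. Qed.

Lemma hnorm0 : hnorm (0 : Z) = 0.
Proof. by rewrite /hnorm normr0 raddf0. Qed.

Lemma hnorm_eq0 x : hnorm x = 0 -> x = 0.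
Proof. by move=> x0; apply/normr0_eq0; rewrite -hnormE x0 rmorph0. Qed.

Lemma hnormZ a x : hnorm (of_real k a *: x) = `|a| * hnorm x.
Proof.
apply: (can_inj (@of_realK R k)).
by rewrite hnormE normrZ norm_of_real rmorphM /= hnormE.
Qed.

Lemma hnorm_sqrE x : of_real k (hnorm x ^+ 2) = <|x, x|>.
Proof. by rewrite rmorphXn /= hnormE hilbert_normE. Qed.

Lemma inner_eq0 x : <|x, x|> = 0 -> x = 0.
Proof.
move=> /eqP; rewrite -hnorm_sqrE fmorph_eq0 sqrf_eq0 => /eqP; exact: hnorm_eq0.
Qed.

Lemma cauchy_schwarz x y : `|<|x, y|>| <= `|x| * `|y|.
Proof.
have [->|y0] := eqVneq y 0.
  by rewrite innerC inner0l rmorph0 !normr0 mulr0.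
have yy : 0 < `|y| by rewrite normr_gt0.
rewrite -ler_sqr ?nnegrE ?mulr_ge0// exprMn -ler_pdivrMr ?exprn_gt0//.
(* [c *: y] is the orthogonal projection of [x] on the line of [y]. *)
set c := <|x, y|> / `|y| ^+ 2.
have : 0 <= <|x - c *: y, x - c *: y|>.
  by rewrite /inner -hilbert_normE exprn_ge0.
have -> : <|x - c *: y, x - c *: y|> = `|x| ^+ 2 - `|<|x, y|>| ^+ 2 / `|y| ^+ 2.
  rewrite innerBl !innerDr !innerNr !innerZl !innerZr.
  rewrite -mul_conj_scalar -innerC !hilbert_normE -/(inner x x) -/(inner y y).
  have yy0 : <|y, y|> != 0 by rewrite /inner -hilbert_normE expf_neq0 ?normr_eq0.
  have cc : conj_scalar c = <|y, x|> / <|y, y|>.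
    by rewrite /c hilbert_normE -/(inner y y) rmorphM fmorphV /= -!innerC.
  rewrite cc /c hilbert_normE -/(inner y y).
  by rewrite (divfK yy0) subrr subr0 mulrAC [<|y, x|> * _]mulrC.
by rewrite subr_ge0.
Qed.
End Hilbert.

(** * Convergence in a Hilbert space *)

Section HilbertConvergence.
Context {R : realType} {k : base_field} {Z : hilbertSpace R k}.
Implicit Types (s t : nat -> Z) (x y : Z).

(** The norm of the module takes its values in [scalar R k], where the order is
    partial in the complex case; this restates convergence with the real-valued
    norm. *)
Lemma cvg_hnormP s x :
  s n @[n --> \oo] --> x <->
  forall e : R, 0 < e -> \forall n \near \oo, hnorm (x - s n) < e.
Proof.
split=> [/cvgrPdist_lt sx e e0|sx].
  have /sx : 0 < of_real k e by rewrite of_real_gt0.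
  by apply: filterS => n; rewrite -hnormE ltr_of_real.
apply/cvgrPdist_lt => e e0.
have eE := re_partK (ltW e0).
have /sx : 0 < re_part e by rewrite -(of_real_gt0 (k := k)) eE.
by apply: filterS => n; rewrite -hnormE -[X in _ -> _ < X]eE ltr_of_real.
Qed.

Lemma cvg_hnorm s x : s n @[n --> \oo] --> x ->
  hnorm (s n) @[n --> \oo] --> hnorm x.
Proof.
move=> /cvg_hnormP sx; apply/cvgrPdist_lt => e /sx; apply: filterS => n.
apply: le_lt_trans; rewrite ler_norml; apply/andP; split.
  rewrite lerNl opprB lerBlDl -[hnorm (x - _)]hnormN opprB.
  by apply: le_trans (ler_hnormD _ _); rewrite subrKC.
by rewrite lerBlDl; apply: le_trans (ler_hnormD _ _); rewrite subrKC.
Qed.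

(** Continuity of the inner product, for sequences along which it is eventually
    constant, such as the partial sums of an orthonormal series against one
    of its vectors, or against a vector orthogonal to all of them. *)
Lemma inner_lim_eq s x y c : s n @[n --> \oo] --> x ->
  (\forall n \near \oo, <|s n, y|> = c) -> <|x, y|> = c.
Proof.
move=> /cvg_hnormP sx sc; apply/eqP; rewrite -subr_eq0 -normr_eq0.
have yy : 0 < hnorm y + 1 by rewrite ltr_wpDl ?hnorm_ge0.
set d := `|_|.
have dE : of_real k (re_part d) = d by rewrite re_partK// normr_ge0.
rewrite -dE fmorph_eq0 eq_le -[X in _ && X](ler_of_real (k := k)) dE.
rewrite rmorph0 normr_ge0 andbT; apply/ler_addgt0Pr => e e0; rewrite add0r.
have /sx sxe := divr_gt0 e0 yy.
near \oo => n.
have scn : <|s n, y|> = c by near: n.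
have sxn : hnorm (x - s n) < e / (hnorm y + 1) by near: n.
rewrite -(ler_of_real (k := k)) dE /d -scn -innerBl.
apply: le_trans (cauchy_schwarz _ _) _; rewrite -!hnormE -rmorphM ler_of_real.
apply: (@le_trans _ _ (e / (hnorm y + 1) * (hnorm y + 1))); last first.
  by rewrite divfK// gt_eqF.
by apply: ler_pM; rewrite ?hnorm_ge0// ?lerDl// ltW.
Unshelve. all: by end_near. Qed.

Lemma hilbert_cauchy_cvg s :
  (forall e : R, 0 < e ->
     exists N : nat, forall m n, (N <= m)%N -> (m <= n)%N ->
       hnorm (s n - s m) < e) ->
  cvg (s n @[n --> \oo]).
Proof.
move=> sC; apply: cauchy_cvg; apply/cauchy_exP => e e0.
have eE := re_partK (ltW e0).
have /sC[N sN] : 0 < re_part e by rewrite -(of_real_gt0 (k := k)) eE.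
exists (s N), N => // n /= Nn.
rewrite -ball_normE /ball_/= distrC -hnormE -eE ltr_of_real.
exact: sN.
Qed.

End HilbertConvergence.

(** * Orthonormal series *)

Section OrthonormalSeries.
Context {R : realType} {k : base_field} {Z : hilbertSpace R k}.

Definition orthonormal_on (I : set nat) (w : nat -> Z) :=
  forall m n, I m -> I n -> <|w m, w n|> = (m == n)%:R.

Context (I : set nat) (w : nat -> Z) (ow : orthonormal_on I w).
Implicit Types (a : nat -> scalar R k) (m n : nat) (x : Z).

Lemma inner_partial_sum a m n : I m -> (m < n)%N ->
  <|partial_sums I (fun i => a i *: w i) n, w m|> = a m.
Proof.
move=> Im mn; rewrite /partial_sums inner_suml.
rewrite (bigD1 (Ordinal mn)) ?mem_set//= innerZl ow// eqxx mulr1.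
rewrite big1 ?addr0// => i /andP[/set_mem Ii im]; rewrite innerZl ow//.
by rewrite (negbTE (_ : (i : nat) != m)) ?mulr0.
Qed.

Definition sqnorm (z : scalar R k) : R := re_part `|z| ^+ 2.

Lemma sqnorm_ge0 z : 0 <= sqnorm z.
Proof. exact: sqr_ge0. Qed.

Lemma of_real_sqnorm (z : scalar R k) : of_real k (sqnorm z) = `|z| ^+ 2.
Proof. by rewrite rmorphXn /= re_partK. Qed.

Definition sqsum a n : R := \sum_(i < n | (i : nat) \in I) sqnorm (a i).

Lemma sqsum_le a m n : (m <= n)%N -> sqsum a m <= sqsum a n.
Proof.
move: m n; apply: (@homo_leq _ (sqsum a) (fun p q => p <= q)) => // [q p r|n].
  exact: le_trans.
rewrite /sqsum [leRHS]big_mkcond big_ord_recr/= -big_mkcond lerDl.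
by case: ifP; rewrite ?sqnorm_ge0.
Qed.

(** A partial sum only sees the coefficients of [z]. Taking for [z] a partial
    sum gives the Pythagorean identities, and taking an arbitrary vector gives
    Bessel's inequality. *)
Lemma inner_partial_sumr z a n : (forall i, I i -> (i < n)%N -> <|z, w i|> = a i) ->
  <|z, partial_sums I (fun i => a i *: w i) n|> = of_real k (sqsum a n).
Proof.
move=> za; rewrite /partial_sums inner_sumr rmorph_sum.
apply: eq_bigr => i /set_mem Ii.
by rewrite innerZr za// mulrC mul_conj_scalar -of_real_sqnorm.
Qed.

Lemma hnorm_partial_sum_sq a n :
  hnorm (partial_sums I (fun i => a i *: w i) n) ^+ 2 = sqsum a n.
Proof.
apply: (can_inj (@of_realK R k)).
rewrite hnorm_sqrE inner_partial_sumr// => i Ii in_.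
exact: inner_partial_sum.
Qed.

Lemma hnorm_partial_sumB a m n : (m <= n)%N ->
  hnorm (partial_sums I (fun i => a i *: w i) n -
         partial_sums I (fun i => a i *: w i) m) ^+ 2 = sqsum a n - sqsum a m.
Proof.
move=> mn; apply: (can_inj (@of_realK R k)).
set s := partial_sums I _.
have snm : <|s n, s m|> = of_real k (sqsum a m).
  apply: inner_partial_sumr => i Ii im.
  by rewrite inner_partial_sum// (leq_trans im).
have smn : <|s m, s n|> = of_real k (sqsum a m).
  by rewrite innerC snm conj_of_real.
rewrite hnorm_sqrE innerBl !innerDr !innerNr snm smn.
by rewrite -!hnorm_sqrE !hnorm_partial_sum_sq subrr subr0 rmorphB.
Qed.

Lemma bessel x n : sqsum (fun i => <|x, w i|>) n <= hnorm x ^+ 2.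
Proof.
set a := fun i => _; set s := partial_sums I (fun i => a i *: w i) n.
have xs : <|x, s|> = of_real k (sqsum a n) by exact: inner_partial_sumr.
have sx : <|s, x|> = of_real k (sqsum a n) by rewrite innerC xs conj_of_real.
rewrite -subr_ge0.
rewrite (_ : _ - _ = hnorm (x - s) ^+ 2) ?sqr_ge0//.
apply: (can_inj (@of_realK R k)).
rewrite hnorm_sqrE innerBl !innerDr !innerNr xs sx -!hnorm_sqrE.
by rewrite hnorm_partial_sum_sq subrr subr0 rmorphB.
Qed.

(** The Riesz-Fischer theorem: by Pythagoras, the partial sums are Cauchy as soon
    as the bounded nondecreasing sequence of the sums of squares is. *)
Lemma orthonormal_series_cvg a (C : R) : (forall n, sqsum a n <= C) ->
  cvg (partial_sums I (fun i => a i *: w i) n @[n --> \oo]).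
Proof.
move=> aC; apply: hilbert_cauchy_cvg => e e0.
have Qc : cvgn (sqsum a).
  apply: nondecreasing_is_cvgn; first by move=> m n; exact: sqsum_le.
  by exists C => _ [n _ <-].
have Qle := nondecreasing_cvgn_le (fun m n => @sqsum_le a m n) Qc.
have /cvgrPdist_lt/(_ _ (exprn_gt0 2 e0))[N _ QN] := Qc.
exists N => m n Nm mn.
rewrite -ltr_sqr ?nnegrE ?hnorm_ge0 ?ltW// hnorm_partial_sumB//.
apply: le_lt_trans (QN _ Nm); rewrite /= ger0_norm ?subr_ge0 ?Qle//.
by rewrite lerB ?Qle.
Qed.

End OrthonormalSeries.

(** * Diagonal operators between orthonormal families *)

Lemma eq_partial_sums (R : realType) (k : base_field) (Z : hilbertSpace R k)
    (I : set nat) (f g : nat -> Z) (n : nat) :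
  (forall m, (m < n)%N -> I m -> f m = g m) ->
  partial_sums I f n = partial_sums I g n.
Proof. by move=> fg; apply: eq_bigr => i /set_mem /fg; exact. Qed.

Lemma eq_hsum (R : realType) (k : base_field) (Z : hilbertSpace R k)
    (I : set nat) (f g : nat -> Z) :
  (forall m, I m -> f m = g m) -> hsum I f = hsum I g.
Proof.
move=> fg; congr (lim (_ @ \oo)); apply/funext => n.
by apply: eq_partial_sums => m _ /fg.
Qed.

Section Multiplier.
Context {R : realType} {k : base_field} {U W : hilbertSpace R k}.
Context (I : set nat) (v : nat -> U) (w : nat -> W).
Hypotheses (ov : orthonormal_on I v) (ow : orthonormal_on I w).
Implicit Types (c : nat -> R) (x y : U).

(** The common form of the spectral filters and of the orthogonal projection on
    the closed span of [v], which is the case where [w] is [v] and [c] is the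
    constant 1. *)
Definition multiplier c x : W :=
  hsum I (fun m => (of_real k (c m) * <|x, v m|>) *: w m).

Lemma sqsum_multiplier c x n : (forall m, I m -> `|c m| <= 1) ->
  sqsum I (fun m => of_real k (c m) * <|x, v m|>) n <= hnorm x ^+ 2.
Proof.
move=> c1; apply: le_trans (bessel ov x n); apply: ler_sum => i /set_mem Ii.
rewrite -(ler_of_real (k := k)) !of_real_sqnorm normrM exprMn norm_of_real.
have ci : of_real k `|c i| <= 1 by rewrite -(rmorph1 (@of_real R k)) ler_of_real c1.
by rewrite ler_piMl ?exprn_ge0// exprn_ile1// -norm_of_real.
Qed.

Lemma multiplier_cvg c x : (forall m, I m -> `|c m| <= 1) ->
  partial_sums I (fun m => (of_real k (c m) * <|x, v m|>) *: w m) n @[n --> \oo]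
  --> multiplier c x.
Proof.
move=> c1; have := orthonormal_series_cvg ow (fun n => sqsum_multiplier x n c1).
exact.
Qed.

Lemma multiplierB c x y : (forall m, I m -> `|c m| <= 1) ->
  multiplier c (x - y) = multiplier c x - multiplier c y.
Proof.
move=> c1; apply/cvg_lim; first exact: norm_hausdorff.
rewrite (_ : partial_sums I _ =
    (fun n => partial_sums I (fun m => (of_real k (c m) * <|x, v m|>) *: w m) n -
              partial_sums I (fun m => (of_real k (c m) * <|y, v m|>) *: w m) n)).
  exact: cvgB (multiplier_cvg c1) (multiplier_cvg c1).
apply/funext => n; rewrite /partial_sums -sumrB; apply: eq_bigr => i _.
by rewrite innerBl mulrBr scalerBl.
Qed.

Lemma inner_multiplier c x m : (forall m, I m -> `|c m| <= 1) -> I m ->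
  <|multiplier c x, w m|> = of_real k (c m) * <|x, v m|>.
Proof.
move=> c1 Im; apply: inner_lim_eq (multiplier_cvg (x := x) c1) _.
by exists m.+1 => // n /= mn; rewrite (inner_partial_sum ow).
Qed.

Lemma hnorm_multiplier_le c x : (forall m, I m -> `|c m| <= 1) ->
  hnorm (multiplier c x) <= hnorm x.
Proof.
move=> c1; apply: (cvgr_to_le (cvg_hnorm (multiplier_cvg (x := x) c1))).
near=> n; rewrite -ler_sqr ?nnegrE ?hnorm_ge0// (hnorm_partial_sum_sq ow).
exact: sqsum_multiplier.
Unshelve. all: by end_near. Qed.

Lemma partial_sums_stable (Z : hilbertSpace R k) (f : nat -> Z) N n :
  (N <= n)%N -> (forall m, (N <= m)%N -> I m -> f m = 0) ->
  partial_sums I f n = partial_sums I f N.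
Proof.
move=> Nn f0; rewrite /partial_sums [RHS](big_ord_widen_cond n (mem I) f)//.
rewrite [LHS](bigID (fun i : 'I_n => (i < N)%N))/= [X in _ + X]big1 ?addr0//.
by move=> i /andP[/set_mem Ii]; rewrite -leqNgt => /f0; exact.
Qed.

Lemma multiplier_partial_sum c (a : nat -> scalar R k) N :
  multiplier c (partial_sums I (fun m => a m *: v m) N) =
  partial_sums I (fun m => (of_real k (c m) * a m) *: w m) N.
Proof.
apply: lim_near_cst; first exact: norm_hausdorff.
exists N => // n /= Nn; rewrite (partial_sums_stable Nn).
  by apply: eq_partial_sums => m mN Im; rewrite (inner_partial_sum ov).
move=> m Nm Im; rewrite /partial_sums inner_suml big1 ?mulr0 ?scale0r//.
move=> i /set_mem Ii; rewrite innerZl ov//.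
by rewrite (ltn_eqF (leq_trans (ltn_ord i) Nm)) mulr0.
Qed.

End Multiplier.

Section PositiveMultiplier.
Context {R : realType} {k : base_field} {U : hilbertSpace R k}.
Context (I : set nat) (v : nat -> U) (ov : orthonormal_on I v).
Context (c : nat -> R) (c01 : forall m, I m -> 0 <= c m <= 1).
Context (alpha : R) (alpha_gt0 : 0 < alpha).
Local Notation M := (multiplier I v v c).

Let c1 m : I m -> `|c m| <= 1.
Proof. by move=> /c01/andP[c0 ?]; rewrite ger0_norm. Qed.

(** The operator [M] is positive, so the cross term in the expansion of the
    square of the right-hand side is nonnegative. This is computed on the partial
    sums [S], for which the cross term is a finite sum. *)
Lemma hnorm_shift_ge (d : U) : alpha * hnorm d <= hnorm (M d + of_real k alpha *: d).
Proof.
pose s n := partial_sums I (fun m => (of_real k (c m) * <|d, v m|>) *: v m) n.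
have Mc : (s n + of_real k alpha *: d) @[n --> \oo] --> M d + of_real k alpha *: d.
  by apply: cvgD; [exact: multiplier_cvg | exact: cvg_cst].
apply: (cvgr_to_ge (cvg_hnorm Mc)); near=> n.
set S := s n.
rewrite -ler_sqr ?nnegrE ?hnorm_ge0 ?mulr_ge0 ?hnorm_ge0 ?(ltW alpha_gt0)//.
set q := \sum_(i < n | (i : nat) \in I) c i * sqnorm <|d, v i|>.
have dS : <|d, S|> = of_real k q.
  rewrite /S /partial_sums inner_sumr rmorph_sum; apply: eq_bigr => i Ii /=.
  rewrite innerZr [conj_scalar _]rmorphM /= conj_of_real.
  rewrite -mulrA [conj_scalar _ * _]mulrC.
  by rewrite mul_conj_scalar -of_real_sqnorm -rmorphM.
have Sd : <|S, d|> = of_real k q by rewrite innerC dS conj_of_real.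
have q0 : 0 <= q.
  by apply: sumr_ge0 => i /set_mem/c01/andP[ci _]; rewrite mulr_ge0 ?sqnorm_ge0.
have -> : hnorm (S + of_real k alpha *: d) ^+ 2 =
    hnorm S ^+ 2 + 2 * alpha * q + (alpha * hnorm d) ^+ 2.
  apply: (can_inj (@of_realK R k)).
  rewrite hnorm_sqrE innerDl !innerDr !innerZl !innerZr dS Sd -!hnorm_sqrE.
  by rewrite conj_of_real -!rmorphM -!rmorphD /=; congr of_real; ring.
by rewrite lerDr addr_ge0 ?sqr_ge0// !mulr_ge0// ltW.
Unshelve. all: by end_near. Qed.

(** On the span of [v] the inverse of [M + alpha] multiplies by
    1 / (c + alpha), that is by (1 - c / (c + alpha)) / alpha. Written in this
    second way, it is also correct on the orthogonal complement, where it is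
    the division by [alpha]. *)
Lemma shift_surjective (b : U) : exists x, M x + of_real k alpha *: x = b.
Proof.
pose t m := c m / (c m + alpha).
have t1 m : I m -> `|t m| <= 1.
  move=> /c01/andP[c0 _]; rewrite ger0_norm ?divr_ge0 ?addr_ge0 ?(ltW alpha_gt0)//.
  by rewrite ler_pdivrMr ?ltr_wpDl// mul1r lerDl ltW.
have a0 : of_real k alpha != 0 by rewrite fmorph_eq0 gt_eqF.
exists ((of_real k alpha)^-1 *: (b - multiplier I v v t b)).
rewrite scalerA divff// scale1r.
suff -> : M ((of_real k alpha)^-1 *: (b - multiplier I v v t b)) =
    multiplier I v v t b.
  by rewrite subrKC.
apply: eq_hsum => m Im; congr (_ *: _).
rewrite innerZl innerBl (inner_multiplier ov ov)//.
rewrite -[X in X - _]mul1r -mulrBl !mulrA; congr (_ * _).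
rewrite -(rmorph1 (@of_real R k)) -rmorphB -fmorphV -!rmorphM /=; congr of_real.
have /andP[c0 _] := c01 Im.
rewrite /t; field.
by rewrite !gt_eqF ?ltr_wpDl.
Qed.

End PositiveMultiplier.

(** * Singular expansions and the pseudo-inverse *)

Section SingularExpansion.
Context {R : realType} {k : base_field} {X Y : hilbertSpace R k}.
Context {K : {linear X -> Y}} (E : singular_expansion K).
Local Notation I := (sv_index E).
Local Notation v := (sv_right E).
Local Notation u := (sv_left E).
Local Notation sigma := (sv E).

Let ov : orthonormal_on I v := @sv_right_orthonormal _ _ _ _ _ E.
Let ou : orthonormal_on I u := @sv_left_orthonormal _ _ _ _ _ E.

Lemma inner_sv_left x m : I m -> <|K x, u m|> = of_real k (sigma m) * <|x, v m|>.
Proof.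
move=> Im; apply: (inner_lim_eq (@sv_expansion _ _ _ _ _ E x)).
by exists m.+1 => // n /= mn; rewrite (inner_partial_sum ou).
Qed.

Lemma kernel_sv_right x : (forall m, I m -> <|x, v m|> = 0) -> K x = 0.
Proof.
move=> x0; apply: (cvg_unique (@norm_hausdorff _ _) (@sv_expansion _ _ _ _ _ E x)).
apply: cvg_near_cst; apply: nearW => n.
rewrite /partial_sums big1// => i /set_mem Ii.
by rewrite x0// mulr0 scale0r.
Qed.

Lemma inner_kernel_sv_right a m : K a = 0 -> I m -> <|v m, a|> = 0.
Proof.
move=> Ka Im; rewrite innerC; apply/eqP; rewrite fmorph_eq0.
have := inner_sv_left a Im; rewrite Ka inner0l => /esym/eqP.
by rewrite mulf_eq0 fmorph_eq0 gt_eqF ?sv_gt0.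
Qed.

(** The orthogonal projection on the orthogonal complement of the kernel of
    [K]: the right singular vectors span a dense subspace of it. *)
Definition coimage_proj : X -> X := multiplier I v v (fun=> 1).

Let one_le (m : nat) : I m -> `|1 : R| <= 1.
Proof. by rewrite normr1. Qed.

Lemma inner_coimage_proj x m : I m -> <|coimage_proj x, v m|> = <|x, v m|>.
Proof. by move=> Im; rewrite (inner_multiplier ov ov)// rmorph1 mul1r. Qed.

Lemma coimage_proj_orthocomp x : orthocomp (kernel K) (coimage_proj x).
Proof.
move=> a Ka; apply: inner_lim_eq (multiplier_cvg ov ov one_le) _.
apply: nearW => n; rewrite /partial_sums inner_suml big1// => i /set_mem Ii.
by rewrite innerZl inner_kernel_sv_right// mulr0.
Qed.

Lemma coimage_projE x : K (coimage_proj x) = K x.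
Proof.
apply/eqP; rewrite -subr_eq0 -linearB; apply/eqP; apply: kernel_sv_right => m Im.
by rewrite innerBl inner_coimage_proj// subrr.
Qed.

(** The difference of the two sides lies in the kernel of [K], because its
    coefficients vanish, and both sides are orthogonal to this kernel. *)
Lemma coimage_proj_id x : orthocomp (kernel K) x -> coimage_proj x = x.
Proof.
move=> xK; apply/eqP; rewrite -subr_eq0; apply/eqP/inner_eq0.
rewrite [LHS]innerBl.
have Kd : kernel K (coimage_proj x - x).
  by rewrite /kernel/= linearB coimage_projE subrr.
by rewrite (xK _ Kd) (coimage_proj_orthocomp _ Kd) subrr.
Qed.

(** For [y = K x0] the projection of [x0] is a pseudo-inverse solution; any such
    solution solves [K x = y] exactly, the residual being both in the range and
    orthogonal to it. *)
Lemma pinvP y : range K y -> orthocomp (kernel K) (pinv K y) /\ K (pinv K y) = y.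
Proof.
move=> [x0 _ <-].
have [|pK pR] := xgetPex 0 (P := [set x | orthocomp (kernel K) x /\
    orthocomp (range K) (K x0 - K x)]).
  exists (coimage_proj x0); split; first exact: coimage_proj_orthocomp.
  by rewrite coimage_projE subrr => a _; rewrite inner0l.
split=> //; apply/eqP; rewrite -subr_eq0 -oppr_eq0 opprB; apply/eqP/inner_eq0.
by apply: pR; rewrite -linearB; exists (x0 - pinv K (K x0)).
Qed.

Lemma hnorm_sv_right m : I m -> hnorm (v m) = 1.
Proof.
move=> Im; apply/eqP; rewrite -(@pexpr_eq1 _ _ 2)// ?hnorm_ge0//.
by apply/eqP/(can_inj (@of_realK R k)); rewrite hnorm_sqrE ov// eqxx mulr1n rmorph1.
Qed.

Lemma hnorm_sv_left m : I m -> hnorm (u m) = 1.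
Proof.
move=> Im; apply/eqP; rewrite -(@pexpr_eq1 _ _ 2)// ?hnorm_ge0//.
by apply/eqP/(can_inj (@of_realK R k)); rewrite hnorm_sqrE ou// eqxx mulr1n rmorph1.
Qed.

Lemma sv_le_opnorm m : opnorm K != 0 -> I m -> sigma m <= opnorm K.
Proof.
move=> K0 Im; apply: sup_upper_bound.
  (* The supremum of an unbounded set is 0 by convention. *)
  by apply: contrapT => /sup_out K0'; rewrite /opnorm K0' eqxx in K0.
exists (v m); first by rewrite /= hnorm_sv_right.
by rewrite sv_rightE// hnormZ hnorm_sv_left// mulr1 gtr0_norm// sv_gt0.
Qed.

Hypothesis sigma_le1 : forall m, I m -> sigma m <= 1.

Lemma powR_sv_bounds m s : I m -> 0 <= s -> 0 <= sigma m `^ s <= 1.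
Proof.
move=> Im s0; rewrite powR_ge0/= -(powRr0 (sigma m)).
by rewrite ger_powR// sv_gt0// sigma_le1.
Qed.

Lemma gram_powE s x :
  gram_pow E (s / 2) x = multiplier I v v (fun m => sigma m `^ s) x.
Proof.
apply: eq_hsum => m Im; congr ((of_real k _ * _) *: _).
by rewrite -(powR_mulrn 2 (ltW (sv_gt0 Im))) -powRrM; congr (_ `^ _); field.
Qed.

(** * The iteration and its error *)

Section Iteration.
Context (alpha r : nat -> R).
Hypotheses (alpha_gt0 : forall n, (1 <= n)%N -> 0 < alpha n)
  (r_gt0 : forall n, (1 <= n)%N -> 0 < r n).
Implicit Types (z : Y) (j m n : nat).

Local Notation A j := (multiplier I v v (fun m => sigma m `^ (r j + 1))).
Local Notation B j := (multiplier I u v (fun m => sigma m `^ (r j))).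

Let A01 j m : (1 <= j)%N -> I m -> 0 <= sigma m `^ (r j + 1) <= 1.
Proof. by move=> j1 Im; rewrite powR_sv_bounds// addr_ge0// ltW// r_gt0. Qed.

Let A1 j m : (1 <= j)%N -> I m -> `|sigma m `^ (r j + 1)| <= 1.
Proof. by move=> j1 Im; have /andP[? ?] := A01 j1 Im; rewrite ger0_norm. Qed.

Let B1 j m : (1 <= j)%N -> I m -> `|sigma m `^ (r j)| <= 1.
Proof.
move=> j1 Im; rewrite ger0_norm ?powR_ge0//.
by have /andP[_] := powR_sv_bounds Im (ltW (r_gt0 j1)).
Qed.

(** The iterate is chosen among the solutions of an implicit equation, of which
    [shift_surjective] provides one. *)
Lemma nsiwtS z j :
  A j.+1 (nsiwt E alpha r z j.+1) +
    of_real k (alpha j.+1) *: nsiwt E alpha r z j.+1 =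
  B j.+1 z + of_real k (alpha j.+1) *: nsiwt E alpha r z j.
Proof.
rewrite -gram_powE /=; apply: (xgetPex 0 (P := [set x |
  gram_pow E ((r j.+1 + 1) / 2) x + of_real k (alpha j.+1) *: x =
  gram_pow_adjoint E (r j.+1) z + of_real k (alpha j.+1) *: nsiwt E alpha r z j])).
have [|x xP] := shift_surjective ov (c := fun m => sigma m `^ (r j.+1 + 1)) _
  (alpha_gt0 (ltn0Sn j))
  (gram_pow_adjoint E (r j.+1) z + of_real k (alpha j.+1) *: nsiwt E alpha r z j).
  by move=> m; exact: A01.
by exists x; rewrite /= gram_powE.
Qed.

Lemma gram_pow_adjoint_range x j : (1 <= j)%N -> B j (K x) = A j x.
Proof.
move=> j1; apply: eq_hsum => m Im; rewrite inner_sv_left// mulrA -rmorphM /=.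
by rewrite powRD ?(gt_eqF (sv_gt0 Im)) ?implybT// powRr1 ?(ltW (sv_gt0 Im)).
Qed.

(** The factor by which [n] exact steps reduce the error on the [m]-th right
    singular vector. *)
Definition residual_gain m n : R :=
  \prod_(1 <= i < n.+1) (alpha i / (sigma m `^ (r i + 1) + alpha i)).

(** The error after [n] exact steps if the solution were the truncation of the
    expansion of [x] to its first [N] terms. *)
Definition truncated_residual x N n : X :=
  partial_sums I (fun m => (of_real k (residual_gain m n) * <|x, v m|>) *: v m) N.

Lemma truncated_residualS x N j :
  A j.+1 (truncated_residual x N j.+1) +
    of_real k (alpha j.+1) *: truncated_residual x N j.+1 =
  of_real k (alpha j.+1) *: truncated_residual x N j.
Proof.
rewrite /truncated_residual (multiplier_partial_sum _ ov).
rewrite /partial_sums !scaler_sumr -big_split /=; apply: eq_bigr => i /set_mem Ii.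
rewrite !scalerA -scalerDl !mulrA -mulrDl -!rmorphM -rmorphD /=.
congr ((of_real k _ * _) *: _).
rewrite /residual_gain [in LHS]big_nat_recr//=; set g := \prod_(_ <= _ < _) _.
have a0 := alpha_gt0 (ltn0Sn j); have s0 := powR_ge0 (sigma i) (r j.+1 + 1).
by field; rewrite gt_eqF// ltr_wpDl.
Qed.

(** The vector on the left satisfies the error recurrence, so that a step increases
    its norm by at most [hnorm (K x - z) / alpha j]. *)
Lemma nsiwt_error x z N n :
  hnorm (x - nsiwt E alpha r z n - truncated_residual x N n) <=
  hnorm (x - truncated_residual x N 0) + hnorm (K x - z) * inv_sum alpha n.
Proof.
elim: n => [|j IH]; first by rewrite /inv_sum big_geq// mulr0 addr0 /= subr0.
have a0 := alpha_gt0 (ltn0Sn j).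
rewrite /inv_sum big_nat_recr// -/(inv_sum alpha j) mulrDr addrA.
apply: (@le_trans _ _ (hnorm (x - nsiwt E alpha r z j - truncated_residual x N j) +
  hnorm (K x - z) / alpha j.+1)); last by rewrite lerD2r.
rewrite -(ler_pM2l a0) mulrDr mulrCA divff ?gt_eqF// mulr1.
apply: le_trans (hnorm_shift_ge ov (c := fun m => sigma m `^ (r j.+1 + 1)) _ a0 _) _.
  by move=> m; exact: A01.
have c1 m := @A1 j.+1 m (ltn0Sn j).
rewrite !multiplierB//.
set x' := nsiwt E alpha r z j.+1; set t' := truncated_residual _ _ j.+1.
rewrite (_ : _ + _ = of_real k (alpha j.+1) *:
    (x - nsiwt E alpha r z j - truncated_residual x N j) + B j.+1 (K x - z)).
  apply: le_trans (ler_hnormD _ _) _; rewrite hnormZ gtr0_norm// lerD2l.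
  by apply: (hnorm_multiplier_le ou ov) => m; exact: B1.
rewrite (multiplierB ou ov); last by move=> m; exact: B1.
rewrite gram_pow_adjoint_range// !scalerBr -(truncated_residualS x N j).
have -> : of_real k (alpha j.+1) *: nsiwt E alpha r z j =
    A j.+1 x' + of_real k (alpha j.+1) *: x' - B j.+1 z.
  by rewrite nsiwtS addrC addKr.
rewrite -/t' !opprD !opprK !addrA.
(* Bring the two occurrences of [B j.+1 z] together at the end. *)
by rewrite [RHS](ACl (7*2*5*1*3*6*(4*8))) /= subrr addr0.
Qed.

Lemma residual_gain_ge0 m n : 0 <= residual_gain m n.
Proof.
rewrite /residual_gain big_nat_cond; apply: prodr_ge0 => i /andP[/andP[i1 _] _].
by rewrite divr_ge0 ?addr_ge0 ?powR_ge0// ltW// alpha_gt0.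
Qed.

(** A product of factors 1 + t_i with t_i >= 0 is at least 1 plus the sum of the
    t_i; here t_i is [sigma m `^ (r i + 1) / alpha i]. *)
Lemma residual_gain_sum_le1 m n :
  residual_gain m n * (1 + \sum_(1 <= i < n.+1) sigma m `^ (r i + 1) / alpha i) <= 1.
Proof.
elim: n => [|n IH]; first by rewrite /residual_gain !big_geq// addr0 mulr1.
rewrite /residual_gain big_nat_recr//= -/(residual_gain m n).
rewrite [X in 1 + X]big_nat_recr//=.
have := residual_gain_ge0 m n.
have a0 := alpha_gt0 (ltn0Sn n); have s0 := powR_ge0 (sigma m) (r n.+1 + 1).
have : 0 <= \sum_(1 <= i < n.+1) sigma m `^ (r i + 1) / alpha i.
  rewrite big_nat_cond; apply: sumr_ge0 => i /andP[/andP[i1 _] _].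
  by rewrite divr_ge0 ?powR_ge0// ltW// alpha_gt0.
move: IH a0 s0; move: (residual_gain m n) (\sum_(_ <= _ < _) _) (alpha _) (_ `^ _).
move=> g S a s IH a0 s0 S0 g0.
apply: le_trans IH; rewrite -mulrA ler_wpM2l//.
rewrite mulrAC ler_pdivrMr ?ltr_wpDl//.
rewrite -subr_ge0.
have -> : (1 + S) * (s + a) - a * (1 + (S + s / a)) = S * s by field; rewrite gt_eqF.
exact: mulr_ge0.
Qed.

(** As [sigma m <= 1], its powers decrease with the exponent, so each
    [r i] may be replaced with the bound [rho]. *)
Lemma residual_gain_le m n rho : I m ->
  (forall i, (1 <= i <= n)%N -> r i <= rho) ->
  residual_gain m n * (sigma m `^ (rho + 1) * inv_sum alpha n) <= 1.
Proof.
move=> Im rrho; apply: le_trans (residual_gain_sum_le1 m n).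
rewrite ler_wpM2l ?residual_gain_ge0//.
apply: (@le_trans _ _ (\sum_(1 <= i < n.+1) sigma m `^ (r i + 1) / alpha i)).
  rewrite /inv_sum mulr_sumr big_nat_cond [leRHS]big_nat_cond.
  apply: ler_sum => i /andP[i1n _]; have /andP[i1 _] := i1n.
  rewrite ler_wpM2r ?invr_ge0 ?(ltW (alpha_gt0 i1))//.
  by rewrite ger_powR ?sv_gt0 ?sigma_le1// lerD2r rrho.
by rewrite lerDr.
Qed.

Lemma inv_sum_ge0 n : 0 <= inv_sum alpha n.
Proof.
rewrite /inv_sum big_nat_cond; apply: sumr_ge0 => i /andP[/andP[i1 _] _].
by rewrite invr_ge0 ltW// alpha_gt0.
Qed.

Lemma inv_sum_gt0 n : (1 <= n)%N -> 0 < inv_sum alpha n.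
Proof.
case: n => // n _; rewrite /inv_sum big_nat_recr//= -/(inv_sum alpha n).
by rewrite ltr_wpDl ?inv_sum_ge0// invr_gt0 alpha_gt0.
Qed.

Lemma residual_gain_cvg0 m : I m ->
  (exists rho : nat -> R, (forall n i, (1 <= i <= n)%N -> r i <= rho n) /\
    sigma m `^ (rho n + 1) * inv_sum alpha n @[n --> \oo] --> +oo) ->
  residual_gain m n @[n --> \oo] --> 0.
Proof.
move=> Im [rho [rrho /cvgryPge rhooo]]; apply/cvgrPdist_le => e e0.
have := rhooo e^-1; apply: filterS => n en.
rewrite sub0r normrN ger0_norm ?residual_gain_ge0//.
have en0 : 0 < sigma m `^ (rho n + 1) * inv_sum alpha n.
  by apply: lt_le_trans en; rewrite invr_gt0.
rewrite -(ler_pM2r en0); apply: le_trans (residual_gain_le Im (rrho n)) _.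
by rewrite -ler_pdivrMl// mulr1.
Qed.

Lemma truncated_residual_cvg0 x N :
  (forall m, I m -> residual_gain m n @[n --> \oo] --> 0) ->
  hnorm (truncated_residual x N n) @[n --> \oo] --> (0 : R).
Proof.
move=> g0; elim: N => [|N IH].
  rewrite (_ : (fun n => _) = (fun=> 0)); first exact: cvg_cst.
  by apply/funext => n; rewrite /truncated_residual /partial_sums big_ord0 hnorm0.
have [/set_mem IN|IN] := boolP (N \in I); last first.
  rewrite (_ : (fun n => _) = (fun n => hnorm (truncated_residual x N n)))//.
  apply/funext => n; rewrite /truncated_residual /partial_sums.
  by rewrite big_mkcond big_ord_recr/= (negbTE IN) addr0 -big_mkcond.
apply: (@squeeze_cvgr _ _ _ _ (fun=> 0) (fun n => hnorm (truncated_residual x N n) +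
    residual_gain N n * hnorm (<|x, v N|> *: v N))).
- apply: nearW => n; rewrite hnorm_ge0/=.
  rewrite /truncated_residual /partial_sums.
  rewrite big_mkcond big_ord_recr/= mem_set// -big_mkcond.
  apply: le_trans (ler_hnormD _ _) _.
  by rewrite lerD2l -scalerA hnormZ ger0_norm// residual_gain_ge0.
- exact: cvg_cst.
- rewrite -[X in _ --> X](addr0 (0 : R)); apply: cvgD => //.
  rewrite -[X in _ --> X](mul0r (hnorm (<|x, v N|> *: v N))).
  by apply: cvgMr_tmp; exact: g0.
Qed.

End Iteration.
End SingularExpansion.

(** * Convergence of the noisy iteration *)

Theorem theorem30 (R : realType) (k : base_field) (X Y : hilbertSpace R k)
    (K : {linear X -> Y}) (E : singular_expansion K)
    (alpha r : nat -> R) (y : Y) (delta : nat -> R) (eta : nat -> Y) :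
  compact_operator K ->
  opnorm K = 1 ->
  (forall n, (1 <= n)%N -> 0 < alpha n) ->
  (forall n, (1 <= n)%N -> 0 < r n) ->
  ((exists rs : R, 0 <= rs /\
      ereal_sup [set (r j)%:E | j in [set j | (1 <= j)%N]] = rs%:E) /\
    inv_sum alpha n @[n --> \oo] --> +oo
   \/
   (forall i j, (1 <= i <= j)%N -> r i <= r j) /\
    r n @[n --> \oo] --> +oo /\
    (forall s : R, (sv_spectrum E `\ 0) s ->
      (fun n => ((inv_sum alpha n)^-1)%R : R^o)
        =o_\oo (fun n => (s `^ (r n + 1))%R : R^o))) ->
  range K y ->
  (forall n, (1 <= n)%N -> 0 <= delta n) ->
  (forall n, (1 <= n)%N -> hnorm (eta n) = 1) ->
  delta n @[n --> \oo] --> (0 : R) ->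
  delta n * inv_sum alpha n @[n --> \oo] --> (0 : R) ->
  hnorm (pinv K y - nsiwt E alpha r (y + of_real k (delta n) *: eta n) n)
    @[n --> \oo] --> (0 : R).
Proof.
move=> _ K1 alpha_gt0 r_gt0 growth yK delta_ge0 eta1 _ deltaS.
have sigma_le1 m : sv_index E m -> sv E m <= 1.
  by move=> Im; rewrite -K1 sv_le_opnorm// K1 oner_neq0.
have gain0 m : sv_index E m -> residual_gain E alpha r m n @[n --> \oo] --> 0.
  move=> Im; apply: residual_gain_cvg0 => //.
  have s0 := sv_gt0 Im.
  case: growth => [[[rs [_ rsE]] Soo]|[r_le [_ So]]].
    exists (fun=> rs); split=> [n i /andP[i1 _]|].
      rewrite -lee_fin -rsE; apply: ereal_sup_ubound.
      by exists i.
    apply/cvgryPge => A; move/cvgryPge: Soo => /(_ (A / sv E m `^ (rs + 1))).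
    by apply: filterS => n; rewrite ler_pdivrMr ?powR_gt0// mulrC.
  exists r; split=> [n i|]; first exact: r_le.
  have /So/eqoP So' : (sv_spectrum E `\ 0) (sv E m).
    split; last by move=> /= s00; rewrite s00 ltxx in s0.
    by apply: subset_closure; exists m.
  apply/cvgryPge => A.
  have A0 : 0 < `|A| + 1 by rewrite ltr_wpDl.
  (* The spectral condition eventually bounds 1 / inv_sum by any positive
     multiple of the power; [`|A| + 1] makes the constant positive. *)
  have := So' (`|A| + 1)^-1; rewrite invr_gt0 => /(_ A0) SA.
  near=> n.
  have n1 : (1 <= n)%N by near: n; exists 1%N.
  have S0 := inv_sum_gt0 alpha_gt0 n1.
  have : `|(inv_sum alpha n)^-1| <= (`|A| + 1)^-1 * `|sv E m `^ (r n + 1)|.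
    by near: n.
  rewrite (ger0_norm (powR_ge0 _ _)) ger0_norm ?invr_ge0 ?(ltW S0)// => nA.
  apply: (@le_trans _ _ (`|A| + 1)).
    by rewrite (le_trans (ler_norm _))// lerDl.
  by rewrite -ler_pdivrMr// -ler_pdivlMl.
have [xK Kx] := pinvP E yK.
set x := pinv K y in xK Kx *.
apply/cvgrPdist_lt => e e0.
have e3 : 0 < e / 3 by rewrite divr_gt0.
(* After 0 steps the gains are empty products, so these are the partial sums
   of the expansion of [x]. *)
have pcvg : truncated_residual E alpha r x N 0 @[N --> \oo] --> x.
  rewrite -[X in _ --> X](coimage_proj_id E xK).
  rewrite (_ : (fun N => _) = partial_sums (sv_index E)
    (fun m => (of_real k 1 * <|x, sv_right E m|>) *: sv_right E m)).
    apply: multiplier_cvg; last by rewrite normr1.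
      exact: sv_right_orthonormal.
    exact: sv_right_orthonormal.
  apply/funext => N; apply: eq_partial_sums => m _ _.
  by rewrite /residual_gain big_geq.
have [N _ /(_ N (leqnn N)) xN] := (cvg_hnormP _ _).1 pcvg _ e3.
have := truncated_residual_cvg0 alpha_gt0 x N gain0.
move/cvgrPdist_lt/(_ _ e3) => tN.
move/cvgrPdist_lt: deltaS => /(_ _ e3) dN.
near=> n.
have n1 : (1 <= n)%N by near: n; exists 1%N.
rewrite sub0r normrN ger0_norm ?hnorm_ge0//.
set z := y + _.
have tn : `|0 - hnorm (truncated_residual E alpha r x N n)| < e / 3 by near: n.
have dn : `|0 - delta n * inv_sum alpha n| < e / 3 by near: n.
rewrite sub0r normrN ger0_norm ?hnorm_ge0// in tn.
rewrite sub0r normrN ger0_norm ?mulr_ge0 ?delta_ge0 ?inv_sum_ge0// in dn.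
have := nsiwt_error sigma_le1 alpha_gt0 r_gt0 x z N n.
have -> : hnorm (K x - z) = delta n.
  rewrite Kx /z opprD addrA subrr sub0r hnormN hnormZ eta1// mulr1.
  by rewrite ger0_norm ?delta_ge0.
move=> err.
rewrite -[x - _](subrK (truncated_residual E alpha r x N n)).
apply: le_lt_trans (ler_hnormD _ _) _.
by move: err tn dn xN => /=; lra.
Unshelve. all: by end_near. Qed.
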